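(* For any $n,k\in\mathbb{Z}$ and $\varepsilon>0$ such that $n>2\log^k(1/\varepsilon)$, there exist $(n,k)$-PMDs $Z_1,\dots,Z_s$ such that $d_{\mathrm{TV}}(Z_i,Z_j)\ge\varepsilon$ for all $1\le i<j\le s$, and $s=\Omega_k\left(n^{k-1}\cdot 2^{\tilde{\Omega}(\log^{k-1}(1/\varepsilon))}\right)$, where the $\tilde\Omega$ in the exponent hides factors of $\mathrm{poly}(\log\log(1/\varepsilon))$ and dependence on $k$.
   Context: A $k$-CRV is a random vector supported on $\{e_1,\dots,e_k\}\subset\mathbb{R}^k$; an $(n,k)$-PMD is the distribution of a sum of $n$ independent $k$-CRVs. $d_{\mathrm{TV}}$ denotes total variation distance.
   Formalization: The formal statement assumes ε ≤ 1: for ε > 1 no two distributions are at total variation distance ε, so s ≤ 1 and the claimed bound fails (e.g. k = 2, ε = 2, n large); log log(1/ε) is replaced by max(1, log log(1/ε)), as it is undefined or small for ε near 1. *)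

(* Defs.v *)
From HB Require Import structures.
From mathcomp Require Import all_boot all_order all_algebra.
From mathcomp Require Import all_classical all_reals all_analysis.

Set Implicit Arguments.
Unset Strict Implicit.
Unset Printing Implicit Defensive.

Import Order.TTheory GRing.Theory Num.Theory.
Import numFieldNormedType.Exports.

Local Open Scope classical_set_scope.
Local Open Scope ring_scope.

(* R^k with its Borel sigma-algebra. *)
Definition Rvec (R : realType) (k : nat) :=
  g_sigma_algebraType (@open 'rV[R]_k).

Section PMD.
Context {R : realType} (k : nat).

Definition std_basis : set (Rvec R k) :=
  [set v | exists j : 'I_k, v = delta_mx 0 j].

Section random_vectors.
Context d (Omega : measurableType d) (P : probability Omega R).

(* "Supported on" is read almost surely. *)
Definition is_CRV (X : {RV P >-> Rvec R k}) : Prop :=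
  P (X @^-1` std_basis) = 1%E.

(* Mutual independence; the product rule for a subfamily is the case where
   the remaining A i are the whole space. *)
Definition mutually_independent (n : nat) (X : 'I_n -> {RV P >-> Rvec R k}) :
    Prop :=
  forall A : 'I_n -> set (Rvec R k), (forall i, measurable (A i)) ->
    P (\bigcap_(i in [set: 'I_n]) (X i @^-1` A i)) =
    (\prod_(i < n) P (X i @^-1` A i))%E.

End random_vectors.

Definition is_PMD (n : nat) (mu : probability (Rvec R k) R) : Prop :=
  exists (d : measure_display) (Omega : measurableType d)
         (P : probability Omega R) (X : 'I_n -> {RV P >-> Rvec R k}),
    [/\ forall i, is_CRV (X i),
        mutually_independent X
      & forall A : set (Rvec R k), measurable A ->
          mu A = P [set w | A (\sum_(i < n) (X i w : 'rV[R]_k))] ].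

End PMD.

Definition dTV {R : realType} d (T : measurableType d)
    (mu nu : probability T R) : \bar R :=
  ereal_sup [set `|mu A - nu A|%E | A in measurable].

(* Main.v *)
Require Import Defs.
From HB Require Import structures.
From mathcomp Require Import all_boot all_order all_algebra.
From mathcomp Require Import all_classical all_reals all_analysis.
From mathcomp Require Import ring lra.

Import Order.TTheory GRing.Theory Num.Theory.
Import numFieldNormedType.Exports.

Local Open Scope classical_set_scope.
Local Open Scope ring_scope.

(** Write [k = K + 1], [L = ln (1 / eps)], and let [G] be the grid [{1..D}^K]
    with [D] of order [L / ln L].  For [S] a subset of [G], sum independent CRVs
    indexed by [g] in [S], the [g]-th one taking the values [e_0, e_1, .., e_K]
    with odds [1 : g_1 / Q : .. : g_K / Q], where [Q = 4 K D^(K+1)].  The count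
    vector [a] has mass [q_S Q^-|a| N_S(a)], where the integer [N_S(a)] is the
    coefficient of [x^a] in the product of the [1 + g . x] over [g] in [S].

    If two such laws are [eps]-close, then [6 eps Q^(KD) <= 1] forces
    [N_S(a) = N_S'(a)] whenever [|a| <= KD].  By Newton's identities the power
    sums of the [g . x] agree in degrees [1 .. KD]; by polarization so do the sums
    of every polynomial of degree at most [KD] that vanishes at the origin, and
    interpolation on the grid gives [S = S'].  This yields [2^(D^K)] laws.

    Since each of them has mass at least [3/4] at one point, translating them by
    deterministic CRVs separates them further and gives the factor [n^K].  For
    [L] bounded the translations alone suffice. *)

(** * Newton's identities for products of linear factors *)

Section PowerSums.
Context {R : numFieldType} {G : finType}.
Implicit Types (u : G -> R) (S : {set G}).

(** The coefficients are the elementary symmetric functions of the [u g] over [S]. *)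
Definition linprod u S : {poly R} := \prod_(g in S) (1 + u g *: 'X).

Lemma linprod_coef0 u S : (linprod u S)`_0 = 1.
Proof.
rewrite -horner_coef0 /linprod horner_prod big1 // => g _.
by rewrite !hornerE.
Qed.

(** Removing a factor is multiplication by the geometric series of [(1 + u g *: 'X)^-1]. *)
Lemma coef_linprodD1 u S g m : g \in S ->
  (linprod u (S :\ g))`_m = \sum_(i < m.+1) (- u g) ^+ i * (linprod u S)`_(m - i).
Proof.
move=> gS; elim: m => [|m IH].
  by rewrite big_ord1 /= expr0 mul1r !linprod_coef0.
have E : linprod u S = (1 + u g *: 'X) * linprod u (S :\ g).
  by rewrite /linprod (big_setD1 g).
have -> : (linprod u (S :\ g))`_m.+1 =
    (linprod u S)`_m.+1 - u g * (linprod u (S :\ g))`_m.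
  by rewrite E mulrDl mul1r -scalerAl coefD coefZ coefXM /= addrK.
rewrite big_ord_recl expr0 mul1r subn0 IH mulr_sumr -sumrN; congr (_ + _).
by apply: eq_bigr => i _; rewrite subSS exprS !mulNr mulrA.
Qed.

Lemma deriv_linprod u S :
  (linprod u S)^`() = \sum_(g in S) u g *: linprod u (S :\ g).
Proof.
have [n] := ubnP #|S|; elim: n S => // n IH S.
have [->|[g gS]] := finset.set_0Vmem S.
  by rewrite /linprod !big_set0 derivC.
rewrite (cardsD1 g) gS => /IH {}IH.
have E : linprod u S = (1 + u g *: 'X) * linprod u (S :\ g).
  by rewrite /linprod (big_setD1 g).
rewrite E derivM IH derivD derivZ derivX derivC add0r [RHS](big_setD1 g) //=.
rewrite -scalerAl mul1r; congr (_ + _); rewrite mulr_sumr.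
apply: eq_bigr => h; rewrite !finset.inE => /andP[hg hS].
rewrite -scalerAr /linprod (big_setD1 g (A := S :\ h)) ?inE ?gS 1?eq_sym ?hg //.
by rewrite !finset.setDDl finset.setUC.
Qed.

Definition powersum u S m : R := \sum_(g in S) u g ^+ m.

Lemma newton_linprod u S m :
  (linprod u S)`_m.+1 *+ m.+1 =
  \sum_(i < m.+1) (-1) ^+ i * powersum u S i.+1 * (linprod u S)`_(m - i).
Proof.
rewrite -coef_deriv deriv_linprod coef_sum.
under eq_bigr => g gS do rewrite coefZ coef_linprodD1 // mulr_sumr.
rewrite exchange_big; apply: eq_bigr => i _ /=.
rewrite /powersum mulr_sumr mulr_suml; apply: eq_bigr => g _.
by rewrite [(- u g) ^+ i]exprNn exprS; ring.
Qed.

(** In Newton's identity of degree [m.+1] the top power sum carries the coefficient [(-1) ^+ m], so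
    strong induction solves for it. Degree 0 is left out because the coefficients do not see the [g]
    with [u g = 0]. *)
Lemma powersum_of_coef u S S' M :
  (forall m, (m <= M)%N -> (linprod u S)`_m = (linprod u S')`_m) ->
  forall m, (0 < m <= M)%N -> powersum u S m = powersum u S' m.
Proof.
move=> H m; have [n] := ubnP m; elim: n m => // n IH [//|m] mn /= mM.
have := congr1 (fun x => x *+ m.+1) (H _ mM); rewrite !newton_linprod.
rewrite !big_ord_recr /= !subnn !linprod_coef0 !mulr1.
rewrite (eq_bigr (fun i : 'I_m =>
  (-1) ^+ i * powersum u S' i.+1 * (linprod u S')`_(m - i))) => [|i _].
  by move/addrI; apply: mulfI; rewrite signr_eq0.
rewrite IH ?H //; last exact: leq_trans (ltn_ord i) (ltnW mM).
  by rewrite (leq_trans (leq_subr _ _)) // ltnW.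
by rewrite (leq_ltn_trans (ltn_ord i)).
Qed.

End PowerSums.

(** * Polarization of vanishing power sums *)

Lemma poly_eq0_horner (R : numFieldType) (p : {poly R}) :
  (forall x, p.[x] = 0) -> p = 0.
Proof.
move=> p0; apply/eqP; apply: contraT => pn0.
have := @max_poly_roots _ p [seq i%:R | i <- iota 0 (size p)] pn0.
rewrite size_map size_iota ltnn; apply.
  by apply/allP => x _; rewrite /root p0.
by rewrite map_inj_uniq ?iota_uniq // => i j /eqP; rewrite eqr_nat => /eqP.
Qed.

Section Polarization.
Context {R : numFieldType} {G : finType} {K : nat}.
Implicit Types (v : G -> 'I_K -> R) (x y : 'I_K -> R).

Definition dot (a x : 'I_K -> R) : R := \sum_j a j * x j.

Lemma dotDr (a x y : 'I_K -> R) t :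
  dot a (fun j => x j + t * y j) = dot a x + t * dot a y.
Proof.
rewrite /dot mulr_sumr -big_split; apply: eq_bigr => j _ /=.
by rewrite mulrDr mulrCA.
Qed.

(** Put [z = x + t y]: the sum is a polynomial in [t] that vanishes identically, and its derivative
    at 0 is [m.+1] times the claimed sum. *)
Lemma polarize v (c : G -> R) x y m :
  (forall z, \sum_g c g * dot (v g) z ^+ m.+1 = 0) ->
  \sum_g c g * dot (v g) y * dot (v g) x ^+ m = 0.
Proof.
move=> H; pose p : {poly R} :=
  \sum_g c g *: ((dot (v g) x)%:P + dot (v g) y *: 'X) ^+ m.+1.
have p0 : p = 0.
  apply: poly_eq0_horner => t; rewrite horner_sum.
  rewrite -[RHS](H (fun j => x j + t * y j)); apply: eq_bigr => g _.
  by rewrite dotDr !hornerE [t * _]mulrC.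
have := congr1 (fun q : {poly R} => q^`().[0]) p0.
rewrite deriv0 horner0 /p raddf_sum horner_sum /= => E.
apply: (@mulIf _ m.+1%:R); first by rewrite pnatr_eq0.
rewrite mul0r -[RHS]E mulr_suml; apply: eq_bigr => g _.
rewrite derivZ deriv_exp derivD derivC derivZ derivX add0r !hornerE hornerMn.
rewrite -mul_polyC mulr1 !hornerE.
ring.
Qed.

(* The exponent of [dot (v g) x] stays positive throughout, because the
   zeroth power sum, i.e. the cardinality, is not assumed to vanish. *)
Lemma polarize_affine v (c : G -> R) M (ls : seq (('I_K -> R) * R)) :
  (forall m z, (0 < m <= M)%N -> \sum_g c g * dot (v g) z ^+ m = 0) ->
  forall m x, (0 < m)%N -> (size ls + m <= M)%N ->
  \sum_g c g * (\prod_(l <- ls) (dot (v g) l.1 + l.2)) * dot (v g) x ^+ m = 0.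
Proof.
move=> H; elim: ls => [|[y b] ls IH] m x m0 /=.
  rewrite add0n => mM; rewrite -[RHS](H m x) ?m0 //.
  by apply: eq_bigr => g _; rewrite big_nil mulr1.
rewrite addSnnS => mM.
have H1 : \sum_g c g * (\prod_(l <- ls) (dot (v g) l.1 + l.2))
    * dot (v g) y * dot (v g) x ^+ m = 0.
  by apply: polarize => z; apply: IH.
have H2 := IH m x m0 (leq_trans (leq_add (leqnn _) (leqnSn m)) mM).
pose P g := \prod_(l <- ls) (dot (v g) l.1 + l.2).
rewrite (eq_bigr (fun g => c g * P g * dot (v g) y * dot (v g) x ^+ m
    + b * (c g * P g * dot (v g) x ^+ m))) => [|g _].
  by rewrite big_split /= H1 add0r -mulr_sumr H2 mulr0.
by rewrite big_cons /= /P; ring.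
Qed.

End Polarization.

(** * Interpolation on the grid *)

Section GridInterpolation.
Context {R : numFieldType} {K D : nat}.
Local Notation G := {ffun 'I_K -> 'I_D}.

Definition gridpt (g : G) (j : 'I_K) : nat := (g j).+1.

(** The factors [x_j - (i + 1)] with [i != g0 j] have a product that vanishes on the grid except at
    [g0]. One more factor [x_j0] makes it vanish at the origin; it is nonzero at [g0] because grid
    coordinates start at 1. The degree is [K (D - 1) + 1], at most [K D]. *)
Lemma grid_interpolation (c : G -> R) : (0 < K)%N ->
  (forall m z, (0 < m <= K * D)%N ->
    \sum_g c g * dot (fun j => (gridpt g j)%:R) z ^+ m = 0) ->
  forall g, c g = 0.
Proof.
move=> K0 H g0; pose j0 : 'I_K := Ordinal K0.
pose e (j i : 'I_K) : R := (i == j)%:R.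
have dote (g : G) j : dot (fun j => (gridpt g j)%:R) (e j) = (gridpt g j)%:R :> R.
  rewrite /dot (bigD1 j) //= /e eqxx mulr1 big1 ?addr0 // => i /negPf ->.
  by rewrite mulr0.
pose ls : seq (('I_K -> R) * R) :=
  [seq (e p.1, - p.2.+1%:R) | p : 'I_K * 'I_D <- enum [pred p : 'I_K * 'I_D | p.2 != g0 p.1]].
(* The pair [(j0, g0 j0)] is not listed, which leaves room for the extra factor. *)
have sls : (size ls + 1 <= K * D)%N.
  rewrite size_map -cardE addn1.
  rewrite -[X in (_ < X * _)%N](card_ord K) -[X in (_ < _ * X)%N](card_ord D).
  rewrite -card_prod; apply/proper_card/properP; split; first exact/subset_predT.
  by exists (j0, g0 j0); rewrite // inE /= eqxx.
have := @polarize_affine _ _ _ (fun g j => (gridpt g j)%:R) c _ ls H 1%N (e j0) isT sls.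
have lsE (g : G) : \prod_(l <- ls) (dot (fun j => (gridpt g j)%:R) l.1 + l.2) =
    \prod_(p : 'I_K * 'I_D | p.2 != g0 p.1) ((gridpt g p.1)%:R - p.2.+1%:R).
  rewrite big_map big_enum_cond /=; apply: eq_big => [p|p _]; rewrite ?andbT //.
  by rewrite /= dote.
rewrite (bigD1 g0) //= [X in _ + X]big1 => [|g gg0].
  rewrite addr0 expr1 dote lsE => /eqP; rewrite !mulf_eq0 pnatr_eq0 orbF.
  case/orP => [/eqP//|/prodf_eq0[p pg]]; rewrite subr_eq0 eqr_nat eqSS.
  by rewrite eq_sym val_eqE (negPf pg).
have [j gj] : exists j, g j != g0 j.
  apply/existsP; rewrite -negb_forall; apply: contra gg0 => /forallP gE.
  by apply/eqP/ffunP => j; apply/eqP.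
rewrite lsE.
by rewrite (bigD1 (j, g j)) //= subrr mul0r mulr0 mul0r.
Qed.

Lemma grid_sum_inj (S S' : {set G}) : (0 < K)%N ->
  (forall (z : 'I_K -> R) m, (m <= K * D)%N ->
    (linprod (fun g => dot (fun j => (gridpt g j)%:R) z) S)`_m =
    (linprod (fun g => dot (fun j => (gridpt g j)%:R) z) S')`_m) ->
  S = S'.
Proof.
move=> K0 H; apply/setP => g.
pose c (g : G) : R := (g \in S)%:R - (g \in S')%:R.
have cE (F : G -> R) :
    \sum_g c g * F g = \sum_(g in S) F g - \sum_(g in S') F g.
  rewrite [X in X - _]big_mkcond [X in _ - X]big_mkcond -sumrB /=.
  apply: eq_bigr => h _; rewrite /c mulrBl.
  by congr (_ - _); case: ifP; rewrite ?mul1r ?mul0r.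
have /(_ g)/eqP : forall g, c g = 0.
  apply: (grid_interpolation _ K0) => m z mM; rewrite cE.
  by apply/eqP; rewrite subr_eq0; apply/eqP/(powersum_of_coef _ _ _ _ (H z)).
by rewrite subr_eq0 eqr_nat; do 2 case: (g \in _).
Qed.
End GridInterpolation.

(** * Count vectors and their generating function *)

Section Counts.
Context {G J : finType}.
Implicit Types (phi : {ffun G -> J}) (o : G -> J -> nat).

(** Counts are bounded by [#|G|] in their type, so that count vectors form a finite type to sum
    over. *)
Definition cnt phi : {ffun J -> 'I_#|G|.+1} :=
  [ffun j => Ordinal (max_card [pred g | phi g == j] : (_ < #|G|.+1)%N)].

Lemma prod_cnt (R : comNzRingType) (F : J -> R) phi :
  \prod_g F (phi g) = \prod_j F j ^+ cnt phi j.
Proof.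
rewrite (partition_big phi predT) //=; apply: eq_bigr => j _.
rewrite ffunE /= -prodr_const; apply: eq_big => [g|g /eqP -> //].
by rewrite inE.
Qed.

(** The coefficient of [Y^a] in the product of the linear forms with coefficients [o g]. It is kept
    in [nat] because distinct integers differ by at least 1. *)
Definition ncount o (a : {ffun J -> 'I_#|G|.+1}) : nat :=
  \sum_(phi : {ffun G -> J} | cnt phi == a) \prod_g o g (phi g).

Lemma prod_sum_ncount (R : comNzRingType) o (Y : J -> R) :
  \prod_g \sum_j (o g j)%:R * Y j =
  \sum_a (ncount o a)%:R * \prod_j Y j ^+ a j.
Proof.
rewrite bigA_distr_bigA (partition_big cnt predT) //=.
apply: eq_bigr => a _; rewrite natr_sum mulr_suml.
apply: eq_bigr => phi /eqP <-.
by rewrite big_split prod_cnt natr_prod.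
Qed.

End Counts.

Section GridOdds.
Context {K : nat} {G : finType} (r : G -> 'I_K -> nat).
Implicit Types (S : {set G}) (a : {ffun 'I_K.+1 -> 'I_#|G|.+1}).

(** Outside [S] the summand is surely [e_0], so all [S] share one index type and one number of
    summands. *)
Definition odds S (g : G) (j : 'I_K.+1) : nat :=
  if unlift ord0 j is Some i then (g \in S) * r g i else 1%N.

Definition wt a : nat := \sum_(i < K) a (lift ord0 i).

Lemma prod_lift0 (R : comNzRingType) (x : R) (y : 'I_K -> R) a :
  \prod_j (if unlift ord0 j is Some i then y i * x else 1) ^+ a j =
  \prod_i y i ^+ a (lift ord0 i) * x ^+ wt a.
Proof.
rewrite big_ord_recl unlift_none expr1n mul1r /wt expr_sum -big_split.
by apply: eq_bigr => i _; rewrite liftK exprMn.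
Qed.

(** Substitute 1 for the 0-th variable and [z_i 'X] for the others in [prod_sum_ncount]; the power
    of ['X] then records [wt a]. *)
Lemma linprod_ncount (R : numFieldType) S (z : 'I_K -> R) :
  linprod (fun g => dot (fun j => (r g j)%:R) z) S =
  \sum_a ((ncount (odds S) a)%:R * \prod_i z i ^+ a (lift ord0 i)) *: 'X^(wt a).
Proof.
pose Y (j : 'I_K.+1) : {poly R} :=
  if unlift ord0 j is Some i then (z i)%:P * 'X else 1.
transitivity (\prod_g \sum_j (odds S g j)%:R * Y j).
  rewrite /linprod big_mkcond; apply: eq_bigr => g _.
  rewrite big_ord_recl /odds /Y !unlift_none mul1r.
  have -> : \sum_(i < K) (match unlift ord0 (lift ord0 i) with
      | Some i0 => (g \in S) * r g i0 | None => 1 end)%N%:R *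
      (match unlift ord0 (lift ord0 i) with
      | Some i0 => (z i0)%:P * 'X | None => 1 end)
      = (g \in S)%:R * (dot (fun j => (r g j)%:R) z *: 'X) :> {poly R}.
    rewrite /dot scaler_suml mulr_sumr; apply: eq_bigr => i _.
    by rewrite !liftK natrM -mulrA mulrA -mul_polyC polyCM polyC_natr !mulrA.
  by case: (g \in S); rewrite ?mul1r ?mul0r ?addr0.
rewrite prod_sum_ncount; apply: eq_bigr => a _.
rewrite prod_lift0 -mul_polyC polyCM polyC_natr rmorph_prod mulrA.
by congr (_ * _ * _); apply: eq_bigr => i _; rewrite rmorphXn.
Qed.

End GridOdds.

Lemma ncount_grid_inj (K D : nat) (S S' : {set {ffun 'I_K -> 'I_D}}) :
  (0 < K)%N ->
  (forall a, (wt a <= K * D)%N ->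
    ncount (odds gridpt S) a = ncount (odds gridpt S') a) ->
  S = S'.
Proof.
move=> K0 H; apply: (@grid_sum_inj rat) => // z m mM.
rewrite !linprod_ncount !coef_sum; apply: eq_bigr => a _.
rewrite !coefZ coefXn; case: eqP => [E|_]; last by rewrite !mulr0.
by rewrite H // -E.
Qed.

(** * Finitely supported laws and the construction of PMDs *)

Section FiniteDistribution.
Context {R : realType} {T : finType} (w : T -> {nonneg R}).
Context d (E : measurableType d) (f : T -> E) (x0 : T).
Hypothesis w_sum1 : \sum_x (w x)%:num = 1.

Definition fin_dist : set E -> \bar R :=
  msum (fun i => mscale (w (nth x0 (enum T) i)) (\d_(f (nth x0 (enum T) i)))) #|T|.

HB.instance Definition _ := Measure.on fin_dist.

Let fin_distE A : fin_dist A = (\sum_x (w x)%:num * (f x \in A)%:R)%:E.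
Proof.
pose F x := ((w x)%:num * (f x \in A)%:R)%:E.
rewrite /fin_dist /= /msum /mscale -sumEFin.
transitivity (\sum_(x <- enum T) F x)%E; last by rewrite big_enum.
rewrite (big_nth x0) big_mkord -cardE.
by apply: eq_bigr => i _; rewrite /F EFinM -indicE.

Qed.

Let fin_distT : fin_dist [set: E] = 1%E.
Proof.
rewrite fin_distE; congr EFin; rewrite -[RHS]w_sum1.
by apply: eq_bigr => x _; rewrite in_setT mulr1.
Qed.

HB.instance Definition _ := Measure_isProbability.Build _ _ _ fin_dist fin_distT.

Lemma fin_dist_nonneg_exists : exists P : probability E R,
  forall A, P A = (\sum_x (w x)%:num * (f x \in A)%:R)%:E.
Proof. by exists fin_dist. Qed.

End FiniteDistribution.

Lemma fin_dist_exists {R : realType} {T : finType} (w : T -> R)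
    d (E : measurableType d) (f : T -> E) :
  (forall x, 0 <= w x) -> \sum_x w x = 1 ->
  exists P : probability E R,
    forall A, P A = (\sum_x w x * (f x \in A)%:R)%:E.
Proof.
move=> w0 w1.
have [x0 _] : exists x0 : T, x0 \in T.
  apply/existsP; apply: contraT; rewrite negb_exists => /forallP T0.
  by move/eqP: w1; rewrite big1 ?[0 == 1]eq_sym ?oner_eq0 // => x; have := T0 x.
exact: (@fin_dist_nonneg_exists R T (fun x => NngNum (w0 x)) d E f x0 w1).
Qed.

Section ProductWeights.
Context {R : realFieldType} {G J : finType} (w : G -> J -> R).
Hypothesis w_sum1 : forall g, \sum_j w g j = 1.

Definition pweight (phi : {ffun G -> J}) : R := \prod_g w g (phi g).

Lemma sum_pweightM (b : G -> J -> R) :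
  \sum_phi pweight phi * \prod_g b g (phi g) =
  \prod_g \sum_j w g j * b g j.
Proof.
rewrite bigA_distr_bigA; apply: eq_bigr => phi _.
by rewrite -big_split.
Qed.

Lemma sum_pweight : \sum_phi pweight phi = 1.
Proof.
transitivity (\prod_g \sum_j w g j); last by rewrite big1.
by rewrite bigA_distr_bigA.
Qed.

Lemma sum_pweight_marginal g0 (b : J -> R) :
  \sum_phi pweight phi * b (phi g0) = \sum_j w g0 j * b j.
Proof.
transitivity (\sum_phi pweight phi *
    \prod_g (if g == g0 then b (phi g) else 1)).
  apply: eq_bigr => phi _; congr (_ * _).
  by rewrite (bigD1 g0) //= eqxx big1 ?mulr1 // => g /negPf ->.
rewrite (sum_pweightM (fun g j => if g == g0 then b j else 1)).
rewrite (bigD1 g0) //= eqxx [X in _ * X]big1 ?mulr1 // => g /negPf ->.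
by rewrite -[RHS](w_sum1 g); apply: eq_bigr => j _; rewrite mulr1.
Qed.

End ProductWeights.

(** Every subset of [nat] is measurable, hence every map out of it; this makes [nat] a convenient
    sample space. *)
Lemma nat_RV_exists {R : realType} (P : probability nat R) d (E : measurableType d)
    (f : nat -> E) : exists X : {RV P >-> E}, forall x, X x = f x.
Proof.
have mf : measurable_fun [set: nat] f by [].
by exists (mfun_Sub (mem_set mf)).
Qed.

Section PMDConstruction.
Context {R : realType} {k : nat} {G J : finType}.
Variables (w : G -> 'I_k -> R) (d : J -> 'I_k).
Hypotheses (w_ge0 : forall g j, 0 <= w g j) (w_sum1 : forall g, \sum_j w g j = 1).

Definition unitv (j : 'I_k) : 'rV[R]_k := delta_mx 0 j.

Lemma indep_prod (b : G -> 'I_k -> R) (c : J -> R) :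
  \sum_phi pweight w phi * (\prod_g b g (phi g) * \prod_i c i) =
  \prod_g (\sum_phi pweight w phi * b g (phi g)) *
  \prod_i (\sum_phi pweight w phi * c i).
Proof.
transitivity (\sum_phi pweight w phi * \prod_g b g (phi g) * \prod_i c i).
  by apply: eq_bigr => phi _; rewrite mulrA.
rewrite -mulr_suml sum_pweightM; congr (_ * _); apply: eq_bigr => x _.
  by rewrite sum_pweight_marginal.
by rewrite -mulr_suml sum_pweight // mul1r.
Qed.

(** The sample space is [nat], where [phi] is coded by its [enum_rank]. Summands in [G] read off a
    coordinate of [phi]; those in [J] are constant. *)
Lemma PMD_exists n : n = (#|G| + #|J|)%N ->
  exists mu : probability (Rvec R k) R, is_PMD n mu /\
    forall A : set 'rV[R]_k, mu A =
      (\sum_phi pweight w phi *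
        (\sum_g unitv (phi g) + \sum_i unitv (d i) \in A)%:R)%:E.
Proof.
rewrite -card_sum => ->.
have pw0 phi : 0 <= pweight w phi by exact: prodr_ge0.
have pw1 := sum_pweight w w_sum1.
have [mu muE] := @fin_dist_exists R _ (pweight w) _ (Rvec R k)
  (fun phi => \sum_g unitv (phi g) + \sum_i unitv (d i)) pw0 pw1.
exists mu; split; last exact: muE.
have [P PE] := @fin_dist_exists R _ (pweight w) _ nat
  (fun phi => enum_rank phi : nat) pw0 pw1.
(* A default value for [nth], available because the total weight is not 0. *)
have [phi0 _] : exists phi : {ffun G -> 'I_k}, phi \in predT.
  apply/existsP; apply: contraT; rewrite negb_exists => /forallP T0.
  by move/eqP: pw1; rewrite big1 ?[0 == 1]eq_sym ?oner_eq0 // => x; have := T0 x.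
pose v (phi : {ffun G -> 'I_k}) (y : G + J) : Rvec R k :=
  match y with inl g => unitv (phi g) | inr i => unitv (d i) end.
have [X XE] : exists X : 'I_#|{: G + J}| -> {RV P >-> Rvec R k},
    forall i phi, X i (enum_rank phi : nat) = v phi (enum_val i).
  have /choice[X XE] : forall i : 'I_#|{: G + J}|, exists Y : {RV P >-> Rvec R k},
      forall m, Y m = v (nth phi0 (enum {ffun G -> 'I_k}) m) (enum_val i).
    by move=> i; apply: nat_RV_exists.
  by exists X => i phi; rewrite XE nth_enum_rank.
exists _, nat, P, X; split.
- move=> i; rewrite /is_CRV PE; congr EFin; rewrite -[X in _ = X]pw1.
  apply: eq_bigr => phi _.
  have -> : (enum_rank phi : nat) \in X i @^-1` (@std_basis R k); last by rewrite mulr1.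
  rewrite inE /preimage /= XE /v.
  by case: (enum_val i) => y; [exists (phi y) | exists (d y)].
- move=> A mA.
  pose A' y := A (enum_rank y).
  have evE i phi : (enum_rank phi : nat) \in X i @^-1` A i =
      (v phi (enum_val i) \in A' (enum_val i)).
    by rewrite /A' enum_valK; apply/idP/idP; rewrite !inE /preimage /= XE.
  rewrite PE (eq_bigr (fun i => (\sum_phi pweight w phi *
      (v phi (enum_val i) \in A' (enum_val i))%:R)%:E)) => [|i _]; last first.
    by rewrite PE; congr EFin; apply: eq_bigr => phi _; rewrite evE.
  rewrite -(big_enum_val (fun y => (\sum_phi pweight w phi *
      (v phi y \in A' y)%:R)%:E)) big_sumType /= -!(big_morph _ (@EFinM R) erefl) -EFinM.
  rewrite -(indep_prod (fun g j => (unitv j \in A' (inl g))%:R)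
    (fun i => (unitv (d i) \in A' (inr i))%:R)).
  congr EFin; apply: eq_bigr => phi _; congr (_ * _).
  (* The indicator of an intersection is the product of the indicators. *)
  transitivity (\prod_(y : G + J) (v phi y \in A' y)%:R : R).
    rewrite (big_enum_val (fun y => (v phi y \in A' y)%:R)).
    case: (boolP (_ \in _)) => [|/negP nin].
      rewrite inE => inA; rewrite big1 // => i _.
      by rewrite -evE mem_set //; apply: inA.
    apply/esym/eqP/prodf_eq0.
    have [i /negPf Ai] : exists i, (enum_rank phi : nat) \notin X i @^-1` A i.
      apply: contrapT => H; apply: nin; rewrite inE => i _; apply/set_mem.
      by apply: contraT => iA; case: H; exists i.
    by exists i => //; rewrite -evE Ai.
  by rewrite big_sumType.
- move=> A mA; rewrite muE PE; congr EFin; apply: eq_bigr => phi _.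
  congr (_ * _%:R); congr nat_of_bool.
  have -> : \sum_g unitv (phi g) + \sum_i unitv (d i) =
      \sum_(i < #|{: G + J}|) (X i (enum_rank phi : nat) : 'rV[R]_k).
    rewrite (eq_bigr (fun i => v phi (enum_val i))) => [|i _]; last by rewrite XE.
    by rewrite -(big_enum_val (v phi)) big_sumType.
  by apply/idP/idP; rewrite !inE.
Qed.
End PMDConstruction.

(** * Lower bounds on total variation from single points *)

Lemma measurable_Rvec_set1 (R : realType) k (x : 'rV[R]_k) :
  measurable ([set x] : set (Rvec R k)).
Proof.
rewrite -[[set x]]setCK; apply: measurableC; apply: sub_sigma_algebra.
by apply/closed_openC/accessible_closed_set1/hausdorff_accessible/norm_hausdorff.
Qed.

Lemma dTV_ge (R : realType) k (mu nu : probability (Rvec R k) R) (eps p q : R) x :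
  mu [set x] = p%:E -> nu [set x] = q%:E -> eps <= `|p - q| ->
  (eps%:E <= dTV mu nu)%E.
Proof.
move=> mux nux epq; apply: (@le_trans _ _ `|p - q|%:E); first by rewrite lee_fin.
apply: ereal_sup_ubound; exists [set x]; first exact: measurable_Rvec_set1.
by rewrite mux nux.
Qed.

(** The induction step is [(1 - x - y) (1 + x) <= 1 - y] for nonnegative [x] and [y]. *)
Lemma prod_inv1D_ge (R : realFieldType) (T : finType) (x : T -> R) :
  (forall t, 0 <= x t) -> 1 - \sum_t x t <= \prod_t (1 + x t)^-1.
Proof.
move=> x0; elim: (index_enum T) => [|t s IH]; first by rewrite !big_nil subr0.
rewrite !big_cons; set p := \prod_(i <- s) _ in IH *; set y := \sum_(i <- s) _ in IH *.
have p0 : 0 <= p by apply: prodr_ge0 => i _; rewrite invr_ge0 addr_ge0.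
have y0 : 0 <= y by apply: sumr_ge0.
have xt0 := x0 t.
rewrite mulrC ler_pdivlMr; last by lra.
by nra.
Qed.

Lemma vec_cnt (R : realType) k (G : finType) (phi : {ffun G -> 'I_k}) :
  \sum_g unitv (phi g) = \row_j (cnt phi j)%:R :> 'rV[R]_k.
Proof.
apply/rowP => j; rewrite summxE mxE ffunE /=.
rewrite -sum1_card natr_sum [RHS]big_mkcond /=; apply: eq_bigr => g _.
by rewrite !mxE eqxx /= eq_sym inE; case: eqP.
Qed.

Lemma vec_cnt_inj (R : realType) k (G : finType) (phi psi : {ffun G -> 'I_k}) :
  (\sum_g unitv (phi g) == \sum_g unitv (psi g) :> 'rV[R]_k) = (cnt phi == cnt psi).
Proof.
rewrite !vec_cnt; apply/eqP/eqP => [/rowP E|-> //].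
apply/ffunP => j; apply/val_inj/eqP; rewrite -(eqr_nat R).
by have := E j; rewrite !mxE => ->.
Qed.

(** * Mass function of the random part *)

Section GridWeights.
Context {R : realFieldType} {K : nat} {G : finType} (r : G -> 'I_K -> nat) (Q : R).
Hypothesis Q_ge0 : 0 <= Q.
Implicit Types (S : {set G}).

(** The factor 1 is written out to match the shape [y i * x] in [prod_lift0]. *)
Let B (j : 'I_K.+1) : R := if unlift ord0 j is Some _ then 1 * Q^-1 else 1.

Definition partition_fun S g : R := \sum_j (odds r S g j)%:R * B j.

Definition gridw S (g : G) (j : 'I_K.+1) : R :=
  (odds r S g j)%:R * B j / partition_fun S g.

(** The constant [q_S]: the normalization of all masses, and also the probability that every summand
    is [e_0]. *)
Definition noneprob S : R := \prod_g (partition_fun S g)^-1.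

Lemma partition_funE S g :
  partition_fun S g = 1 + ((g \in S) * \sum_i r g i)%N%:R / Q.
Proof.
rewrite /partition_fun big_ord_recl /B /odds !unlift_none mulr1; congr (1%:R + _).
rewrite big_distrr /= natr_sum mulr_suml; apply: eq_bigr => i _.
by rewrite !liftK mul1r natrM.
Qed.

Lemma partition_fun_gt0 S g : 0 < partition_fun S g.
Proof.
by rewrite partition_funE ltr_pwDl // divr_ge0 // ler0n.
Qed.

Lemma gridw_ge0 S g j : 0 <= gridw S g j.
Proof.
rewrite /gridw divr_ge0 ?(ltW (partition_fun_gt0 _ _)) // mulr_ge0 ?ler0n //.
by rewrite /B; case: unlift => [_|]; rewrite ?mul1r ?invr_ge0.
Qed.

Lemma gridw_sum1 S g : \sum_j gridw S g j = 1.
Proof. by rewrite -mulr_suml divff // gt_eqF // partition_fun_gt0. Qed.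

Lemma mass_gridw S a :
  \sum_(phi | cnt phi == a) pweight (gridw S) phi =
  noneprob S * Q^-1 ^+ wt a * (ncount (odds r S) a)%:R.
Proof.
rewrite /ncount natr_sum mulr_sumr; apply: eq_bigr => phi /eqP <-.
rewrite /pweight /gridw !big_split /= (prod_cnt R B).
rewrite [X in _ * X * _](prod_lift0 R Q^-1 (fun=> 1)).
rewrite natr_prod [\prod_i 1 ^+ _]big1 ?mul1r => [|i _]; last exact: expr1n.
rewrite /noneprob; ring.
Qed.

Lemma noneprob_ge S : 1 - \sum_g (\sum_i r g i)%N%:R / Q <= noneprob S.
Proof.
apply: (@le_trans _ _ (1 - \sum_g ((g \in S) * \sum_i r g i)%N%:R / Q)).
  rewrite lerD2l lerN2; apply: ler_sum => g _.
  rewrite ler_wpM2r ?invr_ge0 // ler_nat.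
  by case: (g \in S); rewrite ?mul1n ?mul0n.
rewrite /noneprob; under [X in _ <= X]eq_bigr do rewrite partition_funE.
by apply: prod_inv1D_ge => g; rewrite divr_ge0.
Qed.

Definition none : {ffun G -> 'I_K.+1} := [ffun=> ord0].

Lemma pweight_none S : pweight (gridw S) none = noneprob S.
Proof.
apply: eq_bigr => g _.
by rewrite /gridw ffunE /odds /B unlift_none !mul1r.
Qed.

Lemma cnt_none_inj (phi : {ffun G -> 'I_K.+1}) : cnt phi = cnt none -> phi = none.
Proof.
move=> E; apply/ffunP => g; rewrite ffunE; apply/eqP; apply: contraT => gn0.
have /(congr1 val) := congr1 (fun f : {ffun _ -> _} => f (phi g)) E.
rewrite !ffunE /= [RHS]eq_card0 => [/eqP|h]; last first.
  by rewrite inE ffunE eq_sym (negPf gn0).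
by rewrite (cardD1 g) inE eqxx.
Qed.

Lemma mass_gridw_none S :
  \sum_(phi | cnt phi == cnt none) pweight (gridw S) phi = noneprob S.
Proof.
rewrite -pweight_none (bigD1 none) //= big1 ?addr0 // => phi.
by case/andP => /eqP /cnt_none_inj ->; rewrite eqxx.
Qed.

End GridWeights.

(* With [c = Q^-|a|], the numbers [q c N] and [q' c N'] are the masses that two
   of the laws give to the count vector [a]. *)
Lemma nat_eq_of_close (R : realFieldType) (q q' c eps : R) (N N' : nat) :
  2^-1 <= q -> 2^-1 <= q' -> 0 < c -> 6 * eps <= c -> q' * c * N'%:R <= 1 ->
  `|q - q'| < eps -> `|q * c * N%:R - q' * c * N'%:R| < eps -> N = N'.
Proof.
move=> q2 q2' c0 epsc m1 dq dm; apply/eqP; apply: contraT => NN'.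
have H : 1 <= `|N%:R - N'%:R : R|.
  case: (ltngtP N N') NN' => // lt _; last first.
    by apply: (le_trans _ (ler_norm _)); rewrite lerBrDr nat1r ler_nat.
  by rewrite distrC; apply: (le_trans _ (ler_norm _)); rewrite lerBrDr nat1r ler_nat.
have x0 : 0 <= c * N'%:R by rewrite mulr_ge0 ?ler0n ?ltW.
have x2 : c * N'%:R <= 2.
  rewrite -(ler_pM2l (x := 2^-1)) // mulVf //.
  by apply: le_trans m1; rewrite -mulrA ler_wpM2r.
have e0 : 0 < eps by apply: le_lt_trans dq.
(* The right-hand side is below [3 eps] in absolute value, since [c N' <= 2]. The left-hand side is
   at least [c / 2], hence at least [3 eps], if [N] and [N'] differ. *)
have D : q * c * (N%:R - N'%:R) =
    (q * c * N%:R - q' * c * N'%:R) - (q - q') * (c * N'%:R) by ring.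
have : `|q * c * (N%:R - N'%:R)| < 3 * eps.
  rewrite D; apply: (le_lt_trans (ler_normB _ _)).
  rewrite normrM (ger0_norm x0).
  have : `|q - q'| * (c * N'%:R) <= eps * 2 by apply: ler_pM => //; exact: ltW.
  lra.
rewrite normrM ger0_norm; last by rewrite mulr_ge0 ?(ltW c0) //; lra.
have qc : 2^-1 * c <= q * c by rewrite ler_wpM2r // ltW.
have : q * c * 1 <= q * c * `|N%:R - N'%:R|.
  by rewrite ler_wpM2l // mulr_ge0 ?(ltW c0) //; lra.
lra.
Qed.

(** * Translated laws and their separation *)

Section Family.
Context {R : realType} {K : nat} {G : finType} (r : G -> 'I_K -> nat) (Q : R).
Context (n m : nat).
Hypotheses (Q_ge0 : 0 <= Q) (le_n : (#|G| + K * m <= n)%N).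

(* The summands indexed by [J] are deterministic: [t j] of them, for each [j],
   are unit vectors other than the 0-th one. *)
Let J : finType := ('I_K * 'I_m + 'I_(n - (#|G| + K * m)))%type.
Implicit Types (t : {ffun 'I_K -> 'I_m.+1}) (S : {set G}).

Definition shift t (y : J) : 'I_K.+1 :=
  if y is inl p then if (p.2 < t p.1)%N then lift ord0 p.1 else ord0 else ord0.

Definition offset t : 'rV[R]_K.+1 := \sum_y unitv (shift t y).

Lemma offset_lift t j : offset t 0 (lift ord0 j) = (t j)%:R.
Proof.
rewrite /offset summxE big_sumType /= [X in _ + X]big1 ?addr0 => [|i _]; last first.
  by rewrite mxE.
rewrite -(pair_big predT predT
  (fun j' i => unitv (shift t (inl (j', i))) 0 (lift ord0 j))) /=.
rewrite (bigD1 j) //= [X in _ + X]big1 ?addr0 => [|j' j'j]; last first.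
  apply: big1 => i _; rewrite mxE eqxx /=; case: ifP => _ //.
  by rewrite (inj_eq lift_inj) eq_sym (negPf j'j).
transitivity (\sum_(i < m) ((i < t j)%N)%:R : R).
  apply: eq_bigr => i _; rewrite mxE eqxx /=; case: ifP => _ //=.
  by rewrite eqxx.
rewrite -natr_sum; congr _%:R.
rewrite -(big_mkord xpredT (fun i => nat_of_bool (i < t j)%N)).
rewrite (@big_cat_nat _ _ _ (t j)) //=; last by rewrite -ltnS.
rewrite big_nat (eq_bigr (fun=> 1%N)) => [|i /andP[_ ->] //].
rewrite -big_nat sum_nat_const_nat subn0 muln1 big_nat big1 ?addn0 // => i.
by case/andP => ti _; rewrite ltnNge ti.
Qed.

Lemma offset_inj : injective offset.
Proof.
move=> t t' E; apply/ffunP => j; apply/val_inj/eqP; rewrite -(eqr_nat R).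
by rewrite -!offset_lift E.
Qed.

Definition is_law S t (mu : probability (Rvec R K.+1) R) := forall A : set 'rV[R]_K.+1,
  mu A = (\sum_phi pweight (gridw r Q S) phi *
           (\sum_g unitv (phi g) + offset t \in A)%:R)%:E.

Lemma law_exists S t : exists mu, is_PMD n mu /\ is_law S t mu.
Proof.
have nE : n = (#|G| + #|J|)%N.
  by rewrite card_sum card_prod !card_ord addnA subnKC.
exact: (@PMD_exists R K.+1 G J _ (shift t) (gridw_ge0 r Q Q_ge0 S)
  (gridw_sum1 r Q Q_ge0 S) n nE).
Qed.

Lemma law_set1 S t mu (psi : {ffun G -> 'I_K.+1}) : is_law S t mu ->
  mu [set \sum_g unitv (psi g) + offset t] =
  (\sum_(phi | cnt phi == cnt psi) pweight (gridw r Q S) phi)%:E.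
Proof.
move=> ->; congr EFin; rewrite [RHS]big_mkcond; apply: eq_bigr => phi _ /=.
rewrite in_set1 (inj_eq (addIr _)) vec_cnt_inj.
by case: ifP; rewrite ?mulr1 ?mulr0.
Qed.

(** By injectivity of [offset], the outcome [none] lands on another point, so its mass [noneprob] is
    missing here. *)
Lemma law_set1_le S t mu t' : is_law S t mu -> t' != t ->
  exists2 p, mu [set \sum_(g : G) unitv (none g) + offset t'] = p%:E &
             p <= 1 - noneprob r Q S.
Proof.
move=> muE t't; eexists; first exact: muE.
have W0 phi : 0 <= pweight (gridw r Q S) phi.
  by apply: prodr_ge0 => g _; exact: gridw_ge0.
rewrite -pweight_none -[X in _ <= X - _](sum_pweight _ (gridw_sum1 r Q Q_ge0 S)).
rewrite (bigD1 none) //= [X in _ <= X - _](bigD1 none) //=.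
rewrite [X in _ <= X]addrC addKr in_set1 (inj_eq (addrI _)).
rewrite (inj_eq offset_inj) eq_sym (negPf t't) mulr0 add0r.
apply: ler_sum => phi _; apply: ler_piMr; first exact: W0.
by rewrite lern1 leq_b1.
Qed.

(** The test point is the main atom of [mu], to which [nu] gives at most [1 - noneprob r Q S']. *)
Lemma law_separated_shift S S' t t' mu nu (eps : R) : is_law S t mu -> is_law S' t' nu ->
  t != t' -> eps <= noneprob r Q S + noneprob r Q S' - 1 ->
  (eps%:E <= dTV mu nu)%E.
Proof.
move=> muE nuE tt' epsq; have [p pE p1] := law_set1_le _ _ _ _ nuE tt'.
have := law_set1 _ _ _ none muE; rewrite mass_gridw_none => qE.
apply: (dTV_ge _ _ _ _ _ _ _ _ qE pE).
by apply: le_trans (ler_norm _); lra.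
Qed.

(** Comparing masses at the count vector of [none] shows that the normalizations are [eps]-close;
    comparing at [a] then allows [nat_eq_of_close]. *)
Lemma ncount_eq_of_dTV_lt S S' t mu nu eps M : is_law S t mu -> is_law S' t nu ->
  (dTV mu nu < eps%:E)%E -> 1 <= Q ->
  2^-1 <= noneprob r Q S -> 2^-1 <= noneprob r Q S' -> 6 * eps * Q ^+ M <= 1 ->
  forall a, (wt a <= M)%N -> ncount (odds r S) a = ncount (odds r S') a.
Proof.
move=> muE nuE lt_eps Q1 q2 q2' epsQ a aM.
pose p U (psi : {ffun G -> 'I_K.+1}) :=
  \sum_(phi | cnt phi == cnt psi) pweight (gridw r Q U) phi.
have close psi : `|p S psi - p S' psi| < eps.
  rewrite ltNge; apply/negP => /dTV_ge H; move: lt_eps; apply/negP; rewrite -leNgt.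
  by apply: H; [exact: (law_set1 _ _ _ psi muE) | exact: (law_set1 _ _ _ psi nuE)].
(* If no assignment has counts [a], both sides are empty sums. *)
move: aM; have [psi /eqP <- aM|none_a _] := pickP [pred psi | cnt psi == a]; last first.
  by rewrite /ncount !big_pred0.
have Q0 : 0 < Q by lra.
have Qwt : 0 < Q^-1 ^+ wt (cnt psi) by rewrite exprn_gt0 // invr_gt0.
apply: (nat_eq_of_close _ _ _ _ eps _ _ q2 q2' Qwt).
- rewrite exprVn -div1r ler_pdivlMr ?exprn_gt0 //.
  apply: le_trans epsQ; rewrite ler_wpM2l //.
    by have := le_lt_trans (normr_ge0 _) (close psi); lra.
  exact: ler_weXn2l.
- rewrite -mass_gridw -(sum_pweight _ (gridw_sum1 r Q Q_ge0 S')).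
  rewrite big_mkcond; apply: ler_sum => phi _.
  case: ifP => // _; apply: prodr_ge0 => g _; exact: gridw_ge0.
- by have := close none; rewrite /p !mass_gridw_none.
- by rewrite -!mass_gridw; exact: close.
Qed.

End Family.

(** The laws are indexed by pairs [(S, t)]. The bound [(1 + eps) / 2] is what separates different
    [t]; [inj] separates different [S] at equal [t]. The guard [0 < #|G|] lets an empty [G] be used
    with every [eps <= 1]. *)
Lemma family_exists (R : realType) K (G : finType) (r : G -> 'I_K -> nat) (Q eps : R)
    n m M s : s = (2 ^ #|G| * m.+1 ^ K)%N ->
  1 <= Q -> (#|G| + K * m <= n)%N ->
  (forall S, (1 + eps) / 2 <= noneprob r Q S) -> 0 <= eps ->
  ((0 < #|G|)%N -> 6 * eps * Q ^+ M <= 1) ->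
  (forall S S' : {set G},
    (forall a, (wt a <= M)%N -> ncount (odds r S) a = ncount (odds r S') a) -> S = S') ->
  exists Z : 'I_s -> probability (Rvec R K.+1) R,
    (forall i, is_PMD n (Z i)) /\
    (forall i j, i != j -> (eps%:E <= dTV (Z i) (Z j))%E).
Proof.
move=> -> Q1 nG q2 eps0 epsQ inj; have Q0 : 0 <= Q by lra.
pose T := ({set G} * {ffun 'I_K -> 'I_m.+1})%type.
have cardT : (2 ^ #|G| * m.+1 ^ K)%N = #|{: T}|.
  rewrite card_prod card_ffun !card_ord -[#|{: {set G}}|]cardsT -finset.powersetT.
  by rewrite card_powerset cardsT.
have /choice[Z0 Z0P] : forall x : T, exists mu, is_PMD n mu /\
    is_law r Q n m x.1 x.2 mu.
  by move=> x; apply: law_exists.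
exists (fun i => Z0 (enum_val (cast_ord cardT i))); split=> [i|i j ij].
  by case: (Z0P (enum_val (cast_ord cardT i))).
have : enum_val (cast_ord cardT i) != enum_val (cast_ord cardT j).
  by rewrite (inj_eq enum_val_inj) (inj_eq (@cast_ord_inj _ _ _)).
move: (enum_val _) (enum_val _) => [S' t'] [S t].
have [_ L] := Z0P (S, t); have [_ L'] := Z0P (S', t').
have qS := q2 S; have qS' := q2 S'.
have [tt'|tt'] := eqVneq t t'; last first.
  by move=> _; apply: (law_separated_shift _ _ _ _ Q0 _ _ _ _ _ _ _ L L') => //=; lra.
rewrite xpair_eqE tt' eqxx andbT; apply: contraNT; rewrite -ltNge => lt_eps.
apply/eqP; have [G0|/epsQ {}epsQ] := posnP #|G|.
  by apply/setP => g; have := fintype0 g G0.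
apply: inj; rewrite tt' in L.
by apply: (ncount_eq_of_dTV_lt _ _ _ _ Q0 _ _ _ _ _ _ _ L L' lt_eps) => //; lra.
Qed.

(** Each of the [D^K] grid points has coordinate sum at most [K D], so the total is at most
    [K D^(K+1) = Q / 4]. *)
Lemma grid_noneprob_ge (R : realFieldType) K D (S : {set {ffun 'I_K -> 'I_D}}) :
  (0 < K)%N -> (0 < D)%N ->
  3 / 4 <= noneprob gridpt (4 * K%:R * D%:R ^+ K.+1 : R) S.
Proof.
move=> K0 D0; set Q : R := 4 * K%:R * D%:R ^+ K.+1.
have Q0 : 0 < Q by rewrite !mulr_gt0 ?exprn_gt0 ?ltr0n.
apply: le_trans (noneprob_ge _ _ (ltW Q0) _).
suff : \sum_(g : {ffun 'I_K -> 'I_D}) (\sum_i gridpt g i)%N%:R / Q <= 1 / 4 by lra.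
apply: (@le_trans _ _ (\sum_(g : {ffun 'I_K -> 'I_D}) (K * D)%N%:R / Q)).
  apply: ler_sum => g _; rewrite ler_wpM2r ?invr_ge0 ?(ltW Q0) // ler_nat.
  rewrite -[X in (_ <= X * _)%N](card_ord K) -sum_nat_const.
  by apply: leq_sum => i _; exact: ltn_ord.
rewrite sumr_const card_ffun !card_ord -[X in X <= _]mulr_natr mulrAC ler_pdivrMr //.
by rewrite /Q natrX natrM exprS; lra.
Qed.

(** * Choice of the grid size *)

Section Numerics.
Context {R : realType} (K : nat) (L : R).
Hypothesis K_gt0 : (0 < K)%N.

(** Chosen so that [K (K + 2) gridc = 1 / 2], as [grid_eps_bound] requires. *)
Definition gridc : R := (2 * K%:R * (K%:R + 2))^-1.
Definition gridD : nat := Num.truncn (gridc * L / Num.max 1 (ln L)).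
Hypothesis L_ge : 4 / gridc ^+ 2 <= L.

Let K1 : 1 <= K%:R :> R. Proof. by rewrite ler1n. Qed.

Let K0 : K%:R != 0 :> R. Proof. by rewrite pnatr_eq0 -lt0n. Qed.

Let K2 : K%:R + 2 != 0 :> R. Proof. by rewrite -natrD pnatr_eq0 addn2. Qed.

Let c0 : 0 < gridc.
Proof. by rewrite /gridc invr_gt0 !mulr_gt0 ?ltr0n // addr_gt0 ?ltr0n. Qed.

Let c1 : gridc <= 1 / 6.
Proof.
have H : 6 <= 2 * K%:R * (K%:R + 2) :> R.
  have : 0 <= (K%:R - 1) * (K%:R + 3) :> R
    by have := K1; move=> ?; apply: mulr_ge0; lra.
  by lra.
by rewrite /gridc -div1r ler_pdivrMr; lra.
Qed.

Let M := Num.max 1 (ln L).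

Let M1 : 1 <= M. Proof. by rewrite /M le_max lexx. Qed.

Lemma gridL_ge : 4 * K%:R <= L /\ 144 <= L.
Proof.
have : 4 / gridc ^+ 2 = 16 * K%:R ^+ 2 * (K%:R + 2) ^+ 2.
  by rewrite /gridc; field; rewrite ?K0 ?K2.
have k1 := K1.
have : K%:R ^+ 2 * 9 <= K%:R ^+ 2 * (K%:R + 2) ^+ 2 :> R.
  by rewrite ler_wpM2l ?sqr_ge0 //; nra.
by move: L_ge; split; nra.
Qed.

(** With [s = sqrt L], the assumption on [L] reads [2 <= gridc s], so
    [ln L = 2 ln s <= 2 s <= gridc s^2]. *)
Let McL : M <= gridc * L.
Proof.
have [_ L144] := gridL_ge.
have L0 : 0 < L by lra.
have s2 : Num.sqrt L ^+ 2 = L by rewrite sqr_sqrtr // ltW.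
have s0 : 0 < Num.sqrt L by rewrite sqrtr_gt0.
have cs : 2 <= gridc * Num.sqrt L.
  have : 4 <= (gridc * Num.sqrt L) ^+ 2.
    by rewrite exprMn s2 mulrC -ler_pdivrMr // exprn_gt0.
  by have := mulr_gt0 c0 s0; rewrite leNgt => ? ?; apply/negP => ?; nra.
rewrite /M ge_max; apply/andP; split.
  by rewrite -s2; nra.
rewrite -{1}s2 lnXn // -mulr_natl.
have := ln_sublinear s0; nra.
Qed.

Lemma gridD_le : gridD%:R <= gridc * L / M.
Proof.
have [_ L144] := gridL_ge.
have ? := M1; have ? := c0; rewrite /gridD truncn_le -/M divr_ge0 //; last lra.
by rewrite mulr_ge0; lra.
Qed.

Lemma gridD_gt0 : (0 < gridD)%N.
Proof.
have ? := M1; have ? := McL.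
by rewrite /gridD truncn_gt0 -/M ler_pdivlMr ?mul1r //; lra.
Qed.

(** Truncation loses at most a factor 2, since [D + 1 <= 2 D]. *)
Lemma gridD_ge : gridc / 2 * (L / M) <= gridD%:R.
Proof.
have := truncnS_gt (gridc * L / M); rewrite -/M -/gridD.
have : 1 <= gridD%:R :> R by rewrite ler1n gridD_gt0.
rewrite -natr1; lra.
Qed.

Lemma gridD_leL : gridD%:R <= L.
Proof.
have [_ L144] := gridL_ge; have ? := M1; have ? := c0; have ? := c1.
apply: (le_trans gridD_le); rewrite ler_pdivrMr; last by lra.
rewrite mulrC ler_wpM2l; lra.
Qed.

(** From [4 K <= L] and [D <= L] follows [Q <= L^(K+2) <= exp ((K+2) M)]. As [D M <= gridc L], the
    power [Q^(KD)] is at most [exp (L / 2)]; the other half of [exp (- L)] absorbs the 6. *)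
Lemma grid_eps_bound :
  6 * expR (- L) * (4 * K%:R * gridD%:R ^+ K.+1) ^+ (K * gridD) <= 1.
Proof.
have [L4 L144] := gridL_ge; have m1 := M1; have k1 := K1.
have LM : L <= expR M.
  by rewrite -[X in X <= _]lnK ?posrE ?ler_expR ?/M ?le_max ?lexx ?orbT //; lra.
have Q0 : 0 <= 4 * K%:R * gridD%:R ^+ K.+1 :> R.
  by rewrite !mulr_ge0 ?exprn_ge0 ?ler0n.
have e6 : 6 <= expR (L / 2).
  by apply: le_trans (expR_ge1Dx _); lra.
have e1 : expR (L / 2) * expR (- L) * expR (L / 2) = 1.
  have E : L / 2 + - L + L / 2 = 0 by lra.
  by have := @expR0 R; rewrite -{1}E expRD expRD.
have H : (4 * K%:R * gridD%:R ^+ K.+1) ^+ (K * gridD) <= expR (L / 2).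
  apply: (@le_trans _ _ ((expR M ^+ K.+2) ^+ (K * gridD))).
    rewrite lerXn2r ?nnegrE ?exprn_ge0 ?expR_ge0 //.
    apply: (@le_trans _ _ (L ^+ K.+2)).
      rewrite [X in _ <= X]exprS ler_pM ?exprn_ge0 ?ler0n //.
      by rewrite lerXn2r ?nnegrE ?gridD_leL //; lra.
    by rewrite lerXn2r ?nnegrE ?expR_ge0 //; lra.
  rewrite -exprM -expRM_natl ler_expR !natrM.
  have := gridD_le; rewrite ler_pdivlMr ?(lt_le_trans ltr01) // => DM.
  have -> : L / 2 = K.+2%:R * K%:R * (gridc * L).
    by rewrite /gridc -addn2 natrD; field; rewrite ?K0 ?K2.
  rewrite -!mulrA ler_wpM2l // ler_wpM2l //.
have X0 : 0 <= (4 * K%:R * gridD%:R ^+ K.+1) ^+ (K * gridD) :> R by exact: exprn_ge0.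
have a0 := expR_ge0 (- L).
move: X0 H a0 e6 e1; move: (_ ^+ (K * gridD)) (expR (- L)) (expR (L / 2)) => X a b.
move=> X0 Xb a0 b6 e1; rewrite -[X in _ <= X]e1; apply: ler_pM => //.
  by rewrite mulr_ge0.
by rewrite ler_wpM2r.
Qed.

End Numerics.

(** Over the empty index type the laws are point masses at distinct offsets. *)
Lemma deterministic_family (R : realType) K n (eps : R) : 0 <= eps -> eps <= 1 ->
  exists Z : 'I_((n %/ K).+1 ^ K) -> probability (Rvec R K.+1) R,
    (forall i, is_PMD n (Z i)) /\
    (forall i j, i != j -> (eps%:E <= dTV (Z i) (Z j))%E).
Proof.
move=> eps0 eps1.
apply: (@family_exists R K void (fun _ _ => 0%N) 1 eps n (n %/ K) 0); rewrite ?card_void //.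
- by rewrite expn0 mul1n.
- by rewrite add0n mulnC leq_divM.
- by move=> S; rewrite /noneprob big_pred0 => [|[]//]; lra.
- by move=> S S' _; apply/setP => -[].
Qed.

Lemma grid_family (R : realType) K n (L : R) : (0 < K)%N ->
  4 / gridc K ^+ 2 <= L -> (gridD K L ^ K <= n)%N ->
  exists Z : 'I_(2 ^ (gridD K L ^ K) * ((n - gridD K L ^ K) %/ K).+1 ^ K) ->
      probability (Rvec R K.+1) R,
    (forall i, is_PMD n (Z i)) /\
    (forall i j, i != j -> ((expR (- L))%:E <= dTV (Z i) (Z j))%E).
Proof.
move=> K0 L_ge Dn; set D := gridD K L in Dn *.
have D0 : (0 < D)%N by exact: gridD_gt0.
apply: (@family_exists R K {ffun 'I_K -> 'I_D} gridpt (4 * K%:R * D%:R ^+ K.+1)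
  (expR (- L)) n ((n - D ^ K) %/ K) (K * D)); rewrite ?card_ffun ?card_ord //.
- have k1 : 1 <= K%:R :> R by rewrite ler1n.
  have d1 : 1 <= D%:R ^+ K.+1 :> R by rewrite exprn_ege1 // ler1n.
  by nra.
- by rewrite mulnC -leq_subRL // leq_divM.
- move=> S; apply: le_trans (grid_noneprob_ge R K D S K0 D0).
  (* This gives [eps <= 1 / 2], hence [(1 + eps) / 2 <= 3 / 4]. *)
  have : 1 + 1 <= expR L.
    apply: le_trans (expR_ge1Dx _).
    by have [_ L144] := gridL_ge K L K0 L_ge; lra.
  move=> eL; have : expR (- L) <= 1 / 2.
    by rewrite expRN -div1r ler_pdivrMr ?expR_gt0 //; lra.
  by lra.
- by move=> _; exact: grid_eps_bound.
- by move=> S S'; apply: ncount_grid_inj.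
Qed.

Lemma pow_le_divn (R : realFieldType) K n : 
  (n%:R / K%:R) ^+ K <= ((n %/ K).+1 ^ K)%:R :> R.
Proof.
case: K => [|K]; first by rewrite expr0.
rewrite natrX lerXn2r ?nnegrE ?divr_ge0 ?ler0n // ler_pdivrMr ?ltr0n //.
by rewrite -natrM ler_nat ltnW // ltn_ceil.
Qed.

(** * Comparison of the family size with the claimed rate *)

Section Rates.
Context {R : realType} (K : nat) (L : R).
Hypotheses (K_gt0 : (0 < K)%N).

(** The exponent of 2 in the theorem, for [c = (gridc K / 2) ^+ K] and [a = K]. *)
Definition rate_exponent : R :=
  (gridc K / 2) ^+ K * L ^+ K / Num.max 1 (ln L) ^+ K.

Let c0 : 0 < gridc K / 2 :> R.
Proof.
by rewrite divr_gt0 // /gridc invr_gt0 !mulr_gt0 ?ltr0n // addr_gt0 ?ltr0n.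
Qed.

Lemma rate_exponent_le_small L0 : 0 <= L -> L <= L0 ->
  rate_exponent <= (gridc K / 2) ^+ K * L0 ^+ K.
Proof.
move=> L_ge0 LL0; have L0_ge0 := le_trans L_ge0 LL0; rewrite /rate_exponent.
have m1 : 1 <= Num.max 1 (ln L) ^+ K by rewrite exprn_ege1 // le_max lexx.
rewrite ler_pdivrMr ?(lt_le_trans ltr01) //.
have LK : L ^+ K <= L0 ^+ K.
  by apply: lerXn2r.
apply: (le_trans (ler_wpM2l (exprn_ge0 K (ltW c0)) LK)).
by rewrite ler_peMr // mulr_ge0 ?exprn_ge0 ?(ltW c0).
Qed.

Lemma rate_exponent_le_grid : 4 / gridc K ^+ 2 <= L ->
  rate_exponent <= (gridD K L ^ K)%:R.
Proof.
move=> L_ge; have [_ L144] := gridL_ge K L K_gt0 L_ge.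
have m1 : 1 <= Num.max 1 (ln L) by rewrite le_max lexx.
rewrite /rate_exponent -exprMn -expr_div_n natrX lerXn2r ?nnegrE ?ler0n //.
  by apply: divr_ge0; [apply: mulr_ge0; [exact: ltW c0 | lra] | lra].
by rewrite -mulrA; exact: gridD_ge.
Qed.

End Rates.

Theorem theorem5 (R : realType) (k : nat) (hk : (0 < k)%N) :
  exists (C c : R) (a : nat), 0 < C /\ 0 < c /\
    forall (n : nat) (eps : R),
      0 < eps -> eps <= 1 -> 2 * ln (eps^-1) ^+ k < n%:R ->
      exists (s : nat) (Z : 'I_s -> probability (Rvec R k) R),
        (forall i, is_PMD n (Z i)) /\
        (forall i j : 'I_s, (i < j)%N -> (eps%:E <= dTV (Z i) (Z j))%E) /\
        C * (n%:R ^+ k.-1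
             * 2 `^ (c * ln (eps^-1) ^+ k.-1
                     / Num.max 1 (ln (ln (eps^-1))) ^+ a)) <= s%:R.
Proof.
case: k hk => // K _ /=.
have [->|K0] := posnP K.
  (* For [k = 1] the exponent of 2 is 1, so the bound is [1 / 2 * 2 = 1] and a single law
     suffices. *)
  exists (1 / 2), 1, 0%N; split; [lra | split => //].
  move=> n eps eps0 eps1 _.
  have [Z [ZP Zsep]] := deterministic_family R 0 n eps (ltW eps0) eps1.
  exists _, Z; split=> //; split=> [i j ij|].
    by apply: Zsep; rewrite neq_lt; apply/orP; left.
  rewrite !expr0 expn0 !mulr1 divr1 mul1r powRr1 //; lra.
pose c : R := (gridc K / 2) ^+ K.
have gc0 : 0 < gridc K :> R.
  by rewrite /gridc invr_gt0 !mulr_gt0 ?ltr0n // addr_gt0 ?ltr0n.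
pose L0 : R := 4 / gridc K ^+ 2.
pose E := c * L0 ^+ K.
have pE0 : 0 < 2 `^ E :> R by rewrite powR_gt0.
have E0 : 0 <= E by rewrite mulr_ge0 // exprn_ge0 // divr_ge0 // ?ltW // exprn_gt0.
have pE1 : 1 <= 2 `^ E :> R.
  by rewrite -[X in X <= _](powRr0 2) ler_powR // ler1n.
have K20 : 0 < (2 * K%:R : R) ^+ K by rewrite exprn_gt0 // mulr_gt0 // ltr0n.
(* The factor [(2 K)^-K] pays for using only half of the summands as translations, and [2^E] bounds
   the second factor of the rate when [L < L0]. *)
exists ((2 * K%:R) ^- K / 2 `^ E), c, K; split; last split.
- by rewrite divr_gt0 // invr_gt0.
- by rewrite exprn_gt0 // divr_gt0.
move=> n eps eps0 eps1 nL; set L := ln (eps^-1) in nL *.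
have L_ge0 : 0 <= L by rewrite ln_ge0 // invf_ge1.
have epsE : eps = expR (- L) by rewrite /L lnV ?posrE // opprK lnK.
rewrite -/(rate_exponent K L).
have nK0 : 0 <= (n%:R / (2 * K%:R)) ^+ K :> R.
  by rewrite exprn_ge0 // divr_ge0 ?mulr_ge0 ?ler0n.
have bound (x : R) : (2 * K%:R) ^- K / 2 `^ E * (n%:R ^+ K * x) =
    (n%:R / (2 * K%:R)) ^+ K * (x / 2 `^ E).
  by rewrite expr_div_n; field; rewrite !gt_eqF.
have [small|large] := ltP L L0.
  have [Z [ZP Zsep]] := deterministic_family R K n eps (ltW eps0) eps1.
  exists _, Z; split=> //; split=> [i j ij|].
    by apply: Zsep; rewrite neq_lt; apply/orP; left.
  apply: le_trans (pow_le_divn R K n); rewrite bound -[X in _ <= X]mulr1.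
  have n2 : (n%:R / (2 * K%:R)) ^+ K <= (n%:R / K%:R) ^+ K :> R.
    rewrite lerXn2r ?nnegrE ?divr_ge0 ?mulr_ge0 ?ler0n // ler_wpM2l ?ler0n //.
    by rewrite lef_pV2 ?posrE ?mulr_gt0 ?ltr0n // ler_peMl ?ler0n // ler1n.
  apply: ler_pM => //.
  rewrite ler_pdivrMr // mul1r ler_powR ?ler1n //.
  exact: rate_exponent_le_small (ltW small).
have [L4 L144] := gridL_ge K L K0 large.
set D := gridD K L.
(* By the hypothesis on [n], [2 D^K <= 2 L^K <= 2 L^(K+1) < n]: at least half of the summands remain
   for translations. *)
have D2 : (2 * D ^ K <= n)%N.
  rewrite -(ler_nat R); apply: le_trans (ltW nL); rewrite natrM natrX ler_wpM2l //.
  apply: (@le_trans _ _ (L ^+ K)).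
    by rewrite lerXn2r ?nnegrE ?ler0n //; exact: gridD_leL.
  by rewrite exprS ler_peMl ?exprn_ge0 //; lra.
have Dn : (D ^ K <= n)%N by rewrite (leq_trans _ D2) // leq_pmull.
have [Z [ZP Zsep]] := grid_family R K n L K0 large Dn.
rewrite epsE; exists _, Z; split=> //; split=> [i j ij|].
  by apply: Zsep; rewrite neq_lt; apply/orP; left.
rewrite bound natrM [X in _ <= X]mulrC -/D.
apply: ler_pM => //.
  apply: le_trans (pow_le_divn R K (n - D ^ K)).
  rewrite lerXn2r ?nnegrE ?divr_ge0 ?mulr_ge0 ?ler0n //.
  rewrite invfM mulrA ler_wpM2r ?invr_ge0 ?ler0n // natrB //.
  have : (2 * D ^ K)%:R <= n%:R :> R by rewrite ler_nat.
  by rewrite natrM; lra.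
rewrite ler_pdivrMr // (le_trans (_ : _ <= 2 `^ (D ^ K)%:R)) //.
  by rewrite ler_powR ?ler1n //; exact: rate_exponent_le_grid.
by rewrite powR_mulrn // natrX ler_peMr // exprn_ge0.
Qed.
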